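(* The feasible set $$\Omega := \Bigl\{ (\mathbf{x},\mathbf{s}^{\tilde g},\mathbf{s}^{\tilde h})\in\mathbb R^{N}\times\mathbb R^{n_e}\times\mathbb R^{n_i} : \bigl|\tilde{\mathbf g}(\mathbf{x})\bigr| \leq \mathbf{s}^{\tilde g},\ \bigl[\tilde{\mathbf h}(\mathbf{x})\bigr]_{+} \leq \mathbf{s}^{\tilde h} \Bigr\}$$ of the lifted elastic AC optimal power flow problem is contractible, hence path-connected and simply connected. Here $|\cdot|$, $[\,\cdot\,]_+=\max\{\cdot,0\}$ and the inequalities apply componentwise.
   Context: Network data. Buses are $\mathcal N_0=\{0,1,\dots,n_b\}$, where bus $0$ is the slack bus; $\mathcal G\subseteq\mathcal N_0$ is the set of generator buses ($n_g=|\mathcal G|$); $\mathcal L\subseteq\mathcal N_0\times\mathcal N_0$ is the set of branches joining distinct buses ($n_\ell=|\mathcal L|$); $\mathcal L_i$ is the set of branches connected to bus $i$. $\mathbf Y=\mathbf G+\mathrm j\mathbf B$ is the bus admittance matrix with entries $Y_{ik}=G_{ik}+\mathrm jB_{ik}$. Given real data: demands $p_i^{\mathrm d},q_i^{\mathrm d}$ ($i\in\mathcal N_0$), generation bounds $\underline p_i^{\mathrm g},\overline p_i^{\mathrm g},\underline q_i^{\mathrm g},\overline q_i^{\mathrm g}$ ($i\in\mathcal G$), voltage bounds $\underline v_i,\overline v_i$ ($i\in\mathcal N_0$), branch limits $\overline S_\ell$ ($\ell\in\mathcal L$), and cost functions $c_i:\mathbb R\to\mathbb R$ ($i\in\mathcal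 G$). Variables. $\mathbf x=\operatorname{col}(\mathbf v,\boldsymbol\theta,\mathbf p^{\mathrm g},\mathbf q^{\mathrm g},\tilde{\mathbf p}_{\mathcal L},\tilde{\mathbf q}_{\mathcal L})\in\mathbb R^N$ with $N=2n_b+1+2n_g+2n_\ell$: voltage magnitudes $v_i$ ($i\in\mathcal N_0$), angles $\theta_i$ ($i=1,\dots,n_b$; the slack angle is the fixed reference $\theta_0=0$), generations $p_i^{\mathrm g},q_i^{\mathrm g}$ ($i\in\mathcal G$; set to $0$ for $i\notin\mathcal G$), and auxiliary branch flow variables $\tilde p_\ell,\tilde q_\ell$ ($\ell\in\mathcal L$). Power flow functions. With $\theta_{ik}=\theta_i-\theta_k$, for a branch $\ell=(i,k)$: $p_\ell(\mathbf v,\boldsymbol\theta)=v_iv_k(G_{ik}\cos\theta_{ik}+B_{ik}\sin\theta_{ik})$ and $q_\ell(\mathbf v,\boldsymbol\theta)=v_iv_k(G_{ik}\sin\theta_{ik}-B_{ik}\cos\theta_{ik})$. The injections at bus $i$ are the sums of outgoing branch flows, $p_i=\sum_{\ell\in\mathcal L_i}p_\ell$, $q_i=\sum_{\ell\in\mathcal L_i}q_\ell$, where each $\ell\in\mathcal L_i$ is written as $\ell=(i,k)$ with $k$ its other endpoint. Constraints. $\tilde{\mathbf g}(\mathbf x)\in\mathbb R^{n_e}$ collects the residuals $p_i^{\mathrm g}-p_i^{\mathrm d}-p_i(\mathbf v,\boldsymbol\theta)$ and $q_i^{\mathrm g}-q_i^{\mathrm d}-q_i(\mathbf v,\boldsymbol\theta)$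 for $i\in\mathcal N_0$, and $\tilde p_\ell-p_\ell(\mathbf v,\boldsymbol\theta)$, $\tilde q_\ell-q_\ell(\mathbf v,\boldsymbol\theta)$ for $\ell\in\mathcal L$. $\tilde{\mathbf h}(\mathbf x)\in\mathbb R^{n_i}$ collects $\underline p_i^{\mathrm g}-p_i^{\mathrm g}$, $p_i^{\mathrm g}-\overline p_i^{\mathrm g}$, $\underline q_i^{\mathrm g}-q_i^{\mathrm g}$, $q_i^{\mathrm g}-\overline q_i^{\mathrm g}$ ($i\in\mathcal G$), $\underline v_i-v_i$, $v_i-\overline v_i$ ($i\in\mathcal N_0$), and $\tilde p_\ell^2+\tilde q_\ell^2-\overline S_\ell^2$ ($\ell\in\mathcal L$). Lifted elastic problem: minimize $\sum_{i\in\mathcal G}c_i(p_i^{\mathrm g})+\rho_{\tilde g}\mathbf 1^\top\log(\mathbf 1+\mathbf s^{\tilde g})+\rho_{\tilde h}\mathbf 1^\top\log(\mathbf 1+\mathbf s^{\tilde h})$ over $(\mathbf x,\mathbf s^{\tilde g},\mathbf s^{\tilde h})$ subject to $-\mathbf s^{\tilde g}\le\tilde{\mathbf g}(\mathbf x)\le\mathbf s^{\tilde g}$, $\tilde{\mathbf h}(\mathbf x)\le\mathbf s^{\tilde h}$, $\mathbf s^{\tilde g}\ge\mathbf 0$, $\mathbf s^{\tilde h}\ge\mathbf 0$; its feasible set is exactly $\Omega$. *)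

(* Defs.v *)
From HB Require Import structures.
From mathcomp Require Import all_boot all_order all_algebra.
From mathcomp Require Import complex.
From mathcomp Require Import all_classical all_reals all_analysis homotopy.
Import Order.TTheory GRing.Theory Num.Theory.
Import numFieldNormedType.Exports.

Set Implicit Arguments.
Unset Strict Implicit.
Unset Printing Implicit Defensive.

Local Open Scope classical_set_scope.
Local Open Scope ring_scope.

(* The unit interval with its subset topology; bipointed by its endpoints, so
   that {path unit_interval R from x to y in X} is the type of paths in X. *)
Definition unit_interval (R : realType) : Type := set_type `[0%R : R, 1%R]%classic.

HB.instance Definition _ (R : realType) :=
  Topological.copy (unit_interval R) (set_type `[0%R : R, 1%R]%classic).

Lemma unit_interval0_subproof (R : realType) :
  (0 : R) \in `[0%R : R, 1%R]%classic.
Proof. by rewrite inE /= in_itv /= lexx ler01. Qed.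

Lemma unit_interval1_subproof (R : realType) :
  (1 : R) \in `[0%R : R, 1%R]%classic.
Proof. by rewrite inE /= in_itv /= lexx ler01. Qed.

Definition unit_interval0 (R : realType) : unit_interval R :=
  exist _ 0 (unit_interval0_subproof R).

Definition unit_interval1 (R : realType) : unit_interval R :=
  exist _ 1 (unit_interval1_subproof R).

Lemma unit_interval01_subproof (R : realType) :
  unit_interval0 R != unit_interval1 R.
Proof.
by apply/eqP => /(congr1 (@sval _ _)) /= /eqP; rewrite eq_sym oner_eq0.
Qed.

HB.instance Definition _ (R : realType) :=
  isBiPointed.Build (unit_interval R) (unit_interval01_subproof R).

Definition homotopic (R : realType) (X Y : topologicalType) (f g : X -> Y) :=
  exists H : unit_interval R * X -> Y,
    [/\ continuous H,
        forall x, H (unit_interval0 R, x) = f x &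
        forall x, H (unit_interval1 R, x) = g x].

Definition contractible (R : realType) (X : topologicalType) :=
  exists c : X, homotopic R (@idfun X) (cst c).

(* The empty space is not counted as path-connected. *)
Definition path_connected (R : realType) (X : topologicalType) :=
  (exists x : X, True) /\
  forall x y : X, exists p : {path (unit_interval R) from x to y in X}, True.

(* Homotopy relative to the endpoints. *)
Definition path_homotopic (R : realType) (X : topologicalType) (x y : X)
    (p q : {path (unit_interval R) from x to y in X}) :=
  exists H : unit_interval R * unit_interval R -> X,
    [/\ continuous H,
        forall t, H (unit_interval0 R, t) = p t,
        forall t, H (unit_interval1 R, t) = q t,
        forall s, H (s, unit_interval0 R) = x &
        forall s, H (s, unit_interval1 R) = y].

(* Path-connected with trivial fundamental group at every base point. *)
Definition simply_connected (R : realType) (X : topologicalType) :=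
  path_connected R X /\
  forall (x : X) (p : {path (unit_interval R) from x to x in X}),
    path_homotopic p (cst x : {path (unit_interval R) from x to x in X}).

Record network (R : realType) := Network {
  nb : nat;
  gens : {set 'I_nb.+1};
  branches : {set 'I_nb.+1 * 'I_nb.+1};
  branches_distinct : forall l, l \in branches -> l.1 != l.2;
  Ybus : 'M[R[i]]_nb.+1;
  pd : 'cV[R]_nb.+1;
  qd : 'cV[R]_nb.+1;
  pg_lo : 'cV[R]_#|gens|;
  pg_up : 'cV[R]_#|gens|;
  qg_lo : 'cV[R]_#|gens|;
  qg_up : 'cV[R]_#|gens|;
  v_lo : 'cV[R]_nb.+1;
  v_up : 'cV[R]_nb.+1;
  S_up : 'cV[R]_#|branches| }.

Section ACOPF.
Variables (R : realType) (D : network R).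

Local Notation bus := 'I_(nb D).+1.

Definition ng := #|gens D|.
Definition nl := #|branches D|.

(* Generators and branches are indexed by the position of their bus, resp.
   bus pair, in the enumeration of gens D, resp. branches D. *)
Definition gen_bus (j : 'I_ng) : bus := enum_val j.
Definition branch (j : 'I_nl) : bus * bus := enum_val j.

Definition Gbus (i k : bus) : R := complex.Re (Ybus D i k).
Definition Bbus (i k : bus) : R := complex.Im (Ybus D i k).

Definition dimx := ((nb D).+1 + (nb D + (ng + (ng + (nl + nl)))))%N.
Definition dime := ((nb D).+1 + ((nb D).+1 + (nl + nl)))%N.
Definition dimi :=
  (ng + (ng + (ng + (ng + ((nb D).+1 + ((nb D).+1 + nl))))))%N.

Lemma dimxE : dimx = (2 * nb D + 1 + 2 * ng + 2 * nl)%N.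
Proof.
by rewrite /dimx !mul2n -!addnn -!addnA -addn1 -!addnA [(1 + (nb D + _))%N]addnCA.
Qed.

(* The blocks of x = col(v, theta, pg, qg, pl, ql). *)
Definition vmag (x : 'cV[R]_dimx) : 'cV[R]_(nb D).+1 := usubmx x.
Definition vang (x : 'cV[R]_dimx) : 'cV[R]_(nb D) := usubmx (dsubmx x).
Definition pgen (x : 'cV[R]_dimx) : 'cV[R]_ng := usubmx (dsubmx (dsubmx x)).
Definition qgen (x : 'cV[R]_dimx) : 'cV[R]_ng :=
  usubmx (dsubmx (dsubmx (dsubmx x))).
Definition pflow_aux (x : 'cV[R]_dimx) : 'cV[R]_nl :=
  usubmx (dsubmx (dsubmx (dsubmx (dsubmx x)))).
Definition qflow_aux (x : 'cV[R]_dimx) : 'cV[R]_nl :=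
  dsubmx (dsubmx (dsubmx (dsubmx (dsubmx x)))).

(* The angle is 0 at the slack bus; the angle of bus j + 1 is coordinate j of
   the block theta. *)
Definition angle (x : 'cV[R]_dimx) (i : bus) : R :=
  if unlift ord0 i is Some j then vang x j 0 else 0.

(* Extension by 0 to the buses without a generator. *)
Definition at_bus (u : 'cV[R]_ng) (i : bus) : R :=
  \sum_(j < ng | gen_bus j == i) u j 0.

Definition pflow (x : 'cV[R]_dimx) (l : bus * bus) : R :=
  let: (i, k) := l in
  let th := angle x i - angle x k in
  vmag x i 0 * vmag x k 0 * (Gbus i k * cos th + Bbus i k * sin th).

Definition qflow (x : 'cV[R]_dimx) (l : bus * bus) : R :=
  let: (i, k) := l in
  let th := angle x i - angle x k in
  vmag x i 0 * vmag x k 0 * (Gbus i k * sin th - Bbus i k * cos th).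

(* The branches connected to bus i, each written (i, k) with k its other
   endpoint, whichever of (i, k) and (k, i) is recorded in branches D. *)
Definition branches_at (i : bus) : {set bus * bus} :=
  [set l | (l.1 == i) && ((l \in branches D) || ((l.2, l.1) \in branches D))].

Definition pinj (x : 'cV[R]_dimx) (i : bus) : R :=
  \sum_(l in branches_at i) pflow x l.
Definition qinj (x : 'cV[R]_dimx) (i : bus) : R :=
  \sum_(l in branches_at i) qflow x l.

Definition gtilde (x : 'cV[R]_dimx) : 'cV[R]_dime :=
  col_mx (\col_i (at_bus (pgen x) i - pd D i 0 - pinj x i))
 (col_mx (\col_i (at_bus (qgen x) i - qd D i 0 - qinj x i))
 (col_mx (\col_j (pflow_aux x j 0 - pflow x (branch j)))
         (\col_j (qflow_aux x j 0 - qflow x (branch j))))).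

Definition htilde (x : 'cV[R]_dimx) : 'cV[R]_dimi :=
  col_mx (pg_lo D - pgen x)
 (col_mx (pgen x - pg_up D)
 (col_mx (qg_lo D - qgen x)
 (col_mx (qgen x - qg_up D)
 (col_mx (v_lo D - vmag x)
 (col_mx (vmag x - v_up D)
         (\col_j (pflow_aux x j 0 ^+ 2 + qflow_aux x j 0 ^+ 2
                  - S_up D j 0 ^+ 2))))))).

Local Notation lifted_space := ('cV[R]_dimx * 'cV[R]_dime * 'cV[R]_dimi)%type.

(* A point (x, s^g, s^h) is encoded as the pair ((x, s^g), s^h). *)
Definition Omega : set lifted_space :=
  [set z : lifted_space |
    (forall j, `|gtilde z.1.1 j 0| <= z.1.2 j 0) /\
    (forall j, Num.max (htilde z.1.1 j 0) 0 <= z.2 j 0)].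

Definition elastic_feasible : set lifted_space :=
  [set z : lifted_space |
    [/\ forall j, - z.1.2 j 0 <= gtilde z.1.1 j 0 <= z.1.2 j 0,
        forall j, htilde z.1.1 j 0 <= z.2 j 0,
        forall j, 0 <= z.1.2 j 0 &
        forall j, 0 <= z.2 j 0]].

Lemma elastic_feasibleE : elastic_feasible = Omega.
Proof.
apply/seteqP; split=> -[[x sg] sh] /=.
  move=> [gs hs _ sh0]; split=> j; first by rewrite ler_norml gs.
  by rewrite ge_max hs sh0.
move=> [gs hs]; split=> j.
- by rewrite -ler_norml gs.
- by have := hs j; rewrite ge_max => /andP[].
- exact: le_trans (gs j).
- by have := hs j; rewrite ge_max => /andP[].
Qed.

End ACOPF.

Arguments Omega {R} D.
Arguments elastic_feasible {R} D.

(* Main.v *)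
(* [Omega] is the epigraph of a continuous map [F] on a vector space, so sending
   [(x, s)] to [(x, s - F x)] identifies it with the convex set (vector space) x
   (nonnegative orthant). Straight segments of that convex set, read back in
   [Omega], join any two points continuously in the endpoints and are constant
   when the endpoints agree; such a family contracts the space, joins its
   points, and shrinks every loop to its base point while fixing that point. *)

Require Import Defs.
From mathcomp Require Import all_boot all_order all_algebra.
From mathcomp Require Import all_classical all_reals all_analysis homotopy.
Import numFieldNormedType.Exports.

Set Implicit Arguments.
Unset Strict Implicit.
Unset Printing Implicit Defensive.

Import Order.TTheory GRing.Theory Num.Theory.

Local Open Scope classical_set_scope.
Local Open Scope ring_scope.

(** * Continuity of maps into and out of products *)

Lemma continuous_pair (T U V : topologicalType) (f : T -> U) (g : T -> V) :
  continuous f -> continuous g -> continuous (fun t => (f t, g t)).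
Proof.
move=> cf cg t; apply: (@cvg_pair _ _ _ _ (nbhs (f t)) (nbhs (g t))).
  exact: cf.
exact: cg.
Qed.

Lemma continuous_fun_comp (T U V : topologicalType) (f : T -> U) (g : U -> V) :
  continuous f -> continuous g -> continuous (fun t => g (f t)).
Proof. by move=> cf cg t; exact: continuous_comp (cf t) (cg _). Qed.

Lemma continuous_fst (T U V : topologicalType) (f : T -> U * V) :
  continuous f -> continuous (fun t => (f t).1).
Proof. by move=> cf; apply: continuous_fun_comp cf _ => z; exact: cvg_fst. Qed.

Lemma continuous_snd (T U V : topologicalType) (f : T -> U * V) :
  continuous f -> continuous (fun t => (f t).2).
Proof. by move=> cf; apply: continuous_fun_comp cf _ => z; exact: cvg_snd. Qed.

(** * Equiconnected spaces: [L] picks a path between any two points, continuously in both *)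

Section Equiconnected.
Context {R : realType} {X : topologicalType}.
Variable L : unit_interval R * (X * X) -> X.
Hypothesis L_continuous : continuous L.
Hypothesis L_zero : forall a b, L (unit_interval0 R, (a, b)) = a.
Hypothesis L_one : forall a b, L (unit_interval1 R, (a, b)) = b.
Hypothesis L_diag : forall t a, L (t, (a, a)) = a.

Lemma equiconnecting_continuous (T : topologicalType) (t : T -> unit_interval R)
    (a b : T -> X) :
  continuous t -> continuous a -> continuous b ->
  continuous (fun z => L (t z, (a z, b z))).
Proof.
move=> ct ca cb; apply: continuous_fun_comp L_continuous.
by apply: continuous_pair => //; exact: continuous_pair.
Qed.

(** Freezing the second endpoint at [c] makes every point travel to [c] at once. *)
Lemma equiconnected_contractible (c : X) : contractible R X.
Proof.
exists c, (fun z => L (z.1, (z.2, c))); split=> [|x|x] /=.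
- apply: equiconnecting_continuous => z; [exact: cvg_fst|exact: cvg_snd|exact: cvg_cst].
- exact: L_zero.
- exact: L_one.
Qed.

Lemma equiconnected_path_connected (c : X) : path_connected R X.
Proof.
split; first by exists c.
move=> x y; pose f t := L (t, (x, y)).
have cf : continuous f.
  by apply: equiconnecting_continuous => t; [exact: cvg_id|exact: cst_continuous..].
by exists (mk_path cf (L_zero x y) (L_one x y)).
Qed.

(** Each point [p t] of the loop slides along its chosen path to [x]. Both ends of the loop already
    equal [x], so [L_diag] keeps them still and the homotopy is relative to the endpoints. *)
Lemma equiconnected_simply_connected (c : X) : simply_connected R X.
Proof.
split; first exact: equiconnected_path_connected c.
move=> x p; exists (fun z => L (z.1, (p z.2, x))); split=> [|t|t|s|s] /=.
- apply: equiconnecting_continuous => z; [exact: cvg_fst| |exact: cvg_cst].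
  by apply: (@continuous_comp _ _ _ snd p); [exact: cvg_snd|exact: cts_fun].
- exact: L_zero.
- exact: L_one.
- have -> : p (unit_interval0 R) = x by exact: path_zero.
  exact: L_diag.
- have -> : p (unit_interval1 R) = x by exact: path_one.
  exact: L_diag.
Qed.

End Equiconnected.

(** * Pointwise operations on continuous scalar functions *)

Section RealValuedFunctions.
Context {K : numFieldType} {T : topologicalType}.
Implicit Types f g : T -> K.

Lemma continuous_funD f g :
  continuous f -> continuous g -> continuous (fun t => f t + g t).
Proof. by move=> cf cg t; apply: cvgD; [exact: cf|exact: cg]. Qed.

Lemma continuous_funB f g :
  continuous f -> continuous g -> continuous (fun t => f t - g t).
Proof. by move=> cf cg t; apply: cvgB; [exact: cf|exact: cg]. Qed.

Lemma continuous_funM f g :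
  continuous f -> continuous g -> continuous (fun t => f t * g t).
Proof. by move=> cf cg t; apply: cvgM; [exact: cf|exact: cg]. Qed.

Lemma continuous_fun_norm f : continuous f -> continuous (fun t => `|f t|).
Proof. by move=> cf t; apply: cvg_norm; exact: cf. Qed.

End RealValuedFunctions.

Lemma continuous_fun_max (R : realType) (T : topologicalType) (f g : T -> R) :
  continuous f -> continuous g -> continuous (fun t => Num.max (f t) (g t)).
Proof.
by move=> cf cg t; apply: continuous_max; [exact: cf|exact: cg].
Qed.

(** * Continuity of matrix-valued maps, reduced to entries *)

Section ContinuousMatrix.
Context {K : numFieldType} {T : topologicalType}.

(** A neighbourhood of a matrix contains a box of neighbourhoods [P i j] of its entries; the indices
    being finite in number, the entrywise conditions hold simultaneously near [t]. *)
Lemma continuous_mx m n (f : T -> 'M[K]_(m, n)) :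
  (forall i j, continuous (fun t => f t i j)) -> continuous f.
Proof.
move=> cf t A [P fP PA].
suff : \forall u \near t, forall i j, P i j (f u i j).
  by apply: filterS => u Pu; apply: PA.
by apply: filter_forall => i; apply: filter_forall => j; exact: cf (fP i j).
Qed.

Lemma continuous_mxE m n (f : T -> 'M[K]_(m, n)) i j :
  continuous f -> continuous (fun t => f t i j).
Proof.
move=> cf t; apply: (@continuous_comp _ _ _ f (fun M : 'M[K]_(m, n) => M i j)).
  exact: cf.
exact: coord_continuous.
Qed.

Lemma continuous_col_mx m1 m2 n (f : T -> 'M[K]_(m1, n))
    (g : T -> 'M[K]_(m2, n)) :
  continuous f -> continuous g -> continuous (fun t => col_mx (f t) (g t)).
Proof.
move=> cf cg; apply: continuous_mx => i j.
case: (split_ordP i) => k ->.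
  by under eq_fun do rewrite col_mxEu; exact: continuous_mxE.
by under eq_fun do rewrite col_mxEd; exact: continuous_mxE.
Qed.

Lemma continuous_usubmx m1 m2 n (f : T -> 'M[K]_(m1 + m2, n)) :
  continuous f -> continuous (fun t => usubmx (f t)).
Proof.
move=> cf; apply: continuous_mx => i j.
by under eq_fun do rewrite mxE; exact: continuous_mxE.
Qed.

Lemma continuous_dsubmx m1 m2 n (f : T -> 'M[K]_(m1 + m2, n)) :
  continuous f -> continuous (fun t => dsubmx (f t)).
Proof.
move=> cf; apply: continuous_mx => i j.
by under eq_fun do rewrite mxE; exact: continuous_mxE.
Qed.

Lemma continuous_mxD m n (f g : T -> 'M[K]_(m, n)) :
  continuous f -> continuous g -> continuous (fun t => f t + g t).
Proof.
move=> cf cg; apply: continuous_mx => i j.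
under eq_fun do rewrite !mxE.
by apply: continuous_funD; exact: continuous_mxE.
Qed.

Lemma continuous_mxB m n (f g : T -> 'M[K]_(m, n)) :
  continuous f -> continuous g -> continuous (fun t => f t - g t).
Proof.
move=> cf cg; apply: continuous_mx => i j.
under eq_fun do rewrite !mxE.
by apply: continuous_funB; exact: continuous_mxE.
Qed.

Lemma continuous_col n (f : T -> 'I_n -> K) :
  (forall i, continuous (f^~ i)) -> continuous (fun t => \col_i f t i).
Proof.
move=> cf; apply: continuous_mx => i j.
by under eq_fun do rewrite mxE; exact: cf.
Qed.

End ContinuousMatrix.

(** * Continuity of the power flow residuals and constraint functions *)

Section ACOPFContinuity.
Context {R : realType} (D : network R).

Lemma vmag_continuous : continuous (@vmag R D).
Proof. by apply: continuous_usubmx => x; exact: cvg_id. Qed.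

Lemma vang_continuous : continuous (@vang R D).
Proof.
by apply: continuous_usubmx; apply: continuous_dsubmx => x; exact: cvg_id.
Qed.

Lemma pgen_continuous : continuous (@pgen R D).
Proof.
apply: continuous_usubmx; do 2!apply: continuous_dsubmx.
by move=> x; exact: cvg_id.
Qed.

Lemma qgen_continuous : continuous (@qgen R D).
Proof.
apply: continuous_usubmx; do 3!apply: continuous_dsubmx.
by move=> x; exact: cvg_id.
Qed.

Lemma pflow_aux_continuous : continuous (@pflow_aux R D).
Proof.
apply: continuous_usubmx; do 4!apply: continuous_dsubmx.
by move=> x; exact: cvg_id.
Qed.

Lemma qflow_aux_continuous : continuous (@qflow_aux R D).
Proof. by do 5!apply: continuous_dsubmx; move=> x; exact: cvg_id. Qed.

Lemma angle_continuous i : continuous (fun x => @angle R D x i).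
Proof.
(* Whether [i] is the slack bus does not depend on [x], so the case split is made once: a coordinate
   of [vang x], or the constant 0. *)
rewrite /angle; case: unliftP => [j _|_]; last exact: cst_continuous.
exact: continuous_mxE vang_continuous.
Qed.

Lemma at_bus_continuous i : continuous (fun u => @at_bus R D u i).
Proof.
apply: (continuous_big add_continuous) => j _; exact: coord_continuous.
Qed.

Lemma angle_diff_continuous i k :
  continuous (fun x => @angle R D x i - @angle R D x k).
Proof. by apply: continuous_funB; exact: angle_continuous. Qed.

Lemma cos_angle_diff_continuous i k :
  continuous (fun x => cos (@angle R D x i - @angle R D x k)).
Proof.
move=> x; apply: (continuous_comp (@angle_diff_continuous i k x)).
exact: continuous_cos.
Qed.

Lemma sin_angle_diff_continuous i k :
  continuous (fun x => sin (@angle R D x i - @angle R D x k)).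
Proof.
move=> x; apply: (continuous_comp (@angle_diff_continuous i k x)).
exact: continuous_sin.
Qed.

Lemma vmag_prod_continuous i k :
  continuous (fun x => @vmag R D x i 0 * vmag x k 0).
Proof. by apply: continuous_funM; exact: (continuous_mxE vmag_continuous). Qed.

Lemma pflow_continuous l : continuous (fun x => @pflow R D x l).
Proof.
case: l => i k; apply: continuous_funM; first exact: vmag_prod_continuous.
apply: continuous_funD; apply: continuous_funM.
- exact: cst_continuous.
- exact: cos_angle_diff_continuous.
- exact: cst_continuous.
- exact: sin_angle_diff_continuous.
Qed.

Lemma qflow_continuous l : continuous (fun x => @qflow R D x l).
Proof.
case: l => i k; apply: continuous_funM; first exact: vmag_prod_continuous.
apply: continuous_funB; apply: continuous_funM.
- exact: cst_continuous.
- exact: sin_angle_diff_continuous.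
- exact: cst_continuous.
- exact: cos_angle_diff_continuous.
Qed.

Lemma pinj_continuous i : continuous (fun x => @pinj R D x i).
Proof.
by apply: (continuous_big add_continuous) => l _; exact: pflow_continuous.
Qed.

Lemma qinj_continuous i : continuous (fun x => @qinj R D x i).
Proof.
by apply: (continuous_big add_continuous) => l _; exact: qflow_continuous.
Qed.

Lemma gtilde_continuous : continuous (@gtilde R D).
Proof.
(* Four blocks result: active balance, reactive balance, and the residuals of the active and
   reactive auxiliary flows. *)
do 3?apply: continuous_col_mx; apply: continuous_col => i.
- apply: continuous_funB; last exact: pinj_continuous.
  apply: continuous_funB; last exact: cst_continuous.
  move=> x; apply: (@continuous_comp _ _ _ (@pgen R D) (fun u => at_bus u i));
    first exact: pgen_continuous.
  exact: at_bus_continuous.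
- apply: continuous_funB; last exact: qinj_continuous.
  apply: continuous_funB; last exact: cst_continuous.
  move=> x; apply: (@continuous_comp _ _ _ (@qgen R D) (fun u => at_bus u i));
    first exact: qgen_continuous.
  exact: at_bus_continuous.
- apply: continuous_funB; last exact: pflow_continuous.
  exact: (continuous_mxE pflow_aux_continuous).
- apply: continuous_funB; last exact: qflow_continuous.
  exact: (continuous_mxE qflow_aux_continuous).
Qed.

Lemma htilde_continuous : continuous (@htilde R D).
Proof.
do 6?apply: continuous_col_mx.
- by apply: continuous_mxB; [exact: cst_continuous|exact: pgen_continuous].
- by apply: continuous_mxB; [exact: pgen_continuous|exact: cst_continuous].
- by apply: continuous_mxB; [exact: cst_continuous|exact: qgen_continuous].
- by apply: continuous_mxB; [exact: qgen_continuous|exact: cst_continuous].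
- by apply: continuous_mxB; [exact: cst_continuous|exact: vmag_continuous].
- by apply: continuous_mxB; [exact: vmag_continuous|exact: cst_continuous].
- apply: continuous_col => i.
  apply: continuous_funB; last exact: cst_continuous.
  (* A square is a product up to conversion, so each one yields two identical goals. *)
  apply: continuous_funD; apply: continuous_funM.
  + exact: continuous_mxE pflow_aux_continuous.
  + exact: continuous_mxE pflow_aux_continuous.
  + exact: continuous_mxE qflow_aux_continuous.
  + exact: continuous_mxE qflow_aux_continuous.
Qed.

End ACOPFContinuity.

(** * Epigraphs of continuous maps are equiconnected *)

Section Epigraph.
Context {R : realType} (n m p : nat).
Variables (F : 'cV[R]_n -> 'cV[R]_m) (G : 'cV[R]_n -> 'cV[R]_p).
Hypotheses (F_continuous : continuous F) (G_continuous : continuous G).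

(** The epigraph of [(F, G)] for the componentwise order. The triple is nested as in [Omega], which
    makes the two sets equal and not merely homeomorphic. *)
Definition epigraph2 : set ('cV[R]_n * 'cV[R]_m * 'cV[R]_p) :=
  [set z : 'cV[R]_n * 'cV[R]_m * 'cV[R]_p |
    (forall j, F z.1.1 j 0 <= z.1.2 j 0) /\
    (forall j, G z.1.1 j 0 <= z.2 j 0)].

Definition lerp k (t : R) (a b : 'cV[R]_k) :=
  \col_i ((1 - t) * a i 0 + t * b i 0).

Lemma lerp0 k (a b : 'cV[R]_k) : lerp 0 a b = a.
Proof.
by apply/matrixP => i j; rewrite mxE ord1 subr0 mul1r mul0r addr0.
Qed.

Lemma lerp1 k (a b : 'cV[R]_k) : lerp 1 a b = b.
Proof.
by apply/matrixP => i j; rewrite mxE ord1 subrr mul1r mul0r add0r.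
Qed.

Lemma lerpxx k t (a : 'cV[R]_k) : lerp t a a = a.
Proof. by apply/matrixP => i j; rewrite mxE ord1 -mulrDl subrK mul1r. Qed.

Lemma lerp_ge0 k t (a b : 'cV[R]_k) j : 0 <= t <= 1 ->
  0 <= a j 0 -> 0 <= b j 0 -> 0 <= lerp t a b j 0.
Proof.
by move=> /andP[t0 t1] a0 b0; rewrite mxE addr_ge0// mulr_ge0// subr_ge0.
Qed.

Lemma continuous_lerp (T : topologicalType) k (t : T -> R)
    (a b : T -> 'cV[R]_k) :
  continuous t -> continuous a -> continuous b ->
  continuous (fun u => lerp (t u) (a u) (b u)).
Proof.
move=> ct ca cb; apply: continuous_col => i.
apply: continuous_funD; apply: continuous_funM.
- by apply: continuous_funB; first exact: cst_continuous.
- exact: continuous_mxE.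
- exact: ct.
- exact: continuous_mxE.
Qed.

(* The slacks [s - F x], not the values [s], are interpolated: this stays in the
   epigraph although [F] and [G] are not convex. *)
Definition epi_lerp (t : R) (a b : 'cV[R]_n * 'cV[R]_m * 'cV[R]_p) :=
  let x := lerp t a.1.1 b.1.1 in
  (x, F x + lerp t (a.1.2 - F a.1.1) (b.1.2 - F b.1.1),
   G x + lerp t (a.2 - G a.1.1) (b.2 - G b.1.1)).

(** Once [F x] or [G x] is cancelled, what remains is that a convex combination of nonnegative
    slacks is nonnegative. *)
Lemma epi_lerp_epigraph t a b : 0 <= t <= 1 ->
  epigraph2 a -> epigraph2 b -> epigraph2 (epi_lerp t a b).
Proof.
move=> t01 [Fa Ga] [Fb Gb]; split=> j /=.
  by rewrite mxE lerDl lerp_ge0// !mxE subr_ge0.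
by rewrite mxE lerDl lerp_ge0// !mxE subr_ge0.
Qed.

Lemma epi_lerp0 a b : epi_lerp 0 a b = a.
Proof.
by case: a => [[x y] z]; rewrite /epi_lerp !lerp0/= ![_ + (_ - _)]addrC !subrK.
Qed.

Lemma epi_lerp1 a b : epi_lerp 1 a b = b.
Proof.
by case: b => [[x y] z]; rewrite /epi_lerp !lerp1/= ![_ + (_ - _)]addrC !subrK.
Qed.

Lemma epi_lerpxx t a : epi_lerp t a a = a.
Proof.
by case: a => [[x y] z]; rewrite /epi_lerp !lerpxx/= ![_ + (_ - _)]addrC !subrK.
Qed.

Lemma continuous_epi_lerp (T : topologicalType) (t : T -> R)
    (a b : T -> 'cV[R]_n * 'cV[R]_m * 'cV[R]_p) :
  continuous t -> continuous a -> continuous b ->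
  continuous (fun u => epi_lerp (t u) (a u) (b u)).
Proof.
move=> ct ca cb.
have ca1 := continuous_fst (continuous_fst ca).
have cb1 := continuous_fst (continuous_fst cb).
have cx : continuous (fun u => lerp (t u) (a u).1.1 (b u).1.1).
  exact: continuous_lerp.
(* Stated for a generic [H], to serve both the [F] and the [G] component. *)
have cs k (H : 'cV[R]_n -> 'cV[R]_k) (y z : T -> 'cV[R]_k) :
    continuous H -> continuous y -> continuous z ->
  continuous (fun u => H (lerp (t u) (a u).1.1 (b u).1.1) +
    lerp (t u) (y u - H (a u).1.1) (z u - H (b u).1.1)).
  move=> cH cy cz; apply: continuous_mxD.
    exact: continuous_fun_comp cx cH.
  apply: continuous_lerp => //; apply: continuous_mxB => //.
    exact: continuous_fun_comp ca1 cH.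
  exact: continuous_fun_comp cb1 cH.
apply: continuous_pair; first apply: continuous_pair => //.
  apply: cs => //; exact/continuous_snd/continuous_fst.
by apply: cs => //; exact: continuous_snd.
Qed.

Lemma epigraph_lerp_subproof (w : unit_interval R * (epigraph2 * epigraph2)) :
  epi_lerp (\val w.1) (\val w.2.1) (\val w.2.2) \in epigraph2.
Proof.
case: w => [[t /= t01] [[a /= aE] [b /= bE]]]; rewrite !inE/= in t01 aE bE *.
by apply: epi_lerp_epigraph => //; rewrite in_itv in t01.
Qed.

(** The equiconnecting map, with values in the subspace itself as the role of [L] requires. *)
Definition epigraph_lerp w : epigraph2 :=
  exist (fun z => z \in epigraph2) _ (epigraph_lerp_subproof w).

(** The subspace topology is initial for the inclusion [\val], so it suffices that the composite
    into the ambient product is continuous. *)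
Lemma epigraph_lerp_continuous : continuous epigraph_lerp.
Proof.
apply: continuous_comp_initial.
have cval : continuous (\val : epigraph2 -> _) by exact: initial_continuous.
have cid : continuous (@id (unit_interval R * (epigraph2 * epigraph2))).
  by move=> w; exact: cvg_id.
apply: continuous_epi_lerp.
- apply: continuous_fun_comp (continuous_fst cid) _.
  exact: initial_continuous.
- exact: continuous_fun_comp (continuous_fst (continuous_snd cid)) cval.
- exact: continuous_fun_comp (continuous_snd (continuous_snd cid)) cval.
Qed.

Lemma epigraph2_contractible_connected :
  [/\ contractible R epigraph2, path_connected R epigraph2
    & simply_connected R epigraph2].
Proof.
have c : epigraph2.
  (* The point of the graph over the origin, with zero slack, shows that the epigraph is
     nonempty. *)
  by exists (0, F 0, G 0); rewrite inE; split=> j /=.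
have L0 a b : epigraph_lerp (unit_interval0 R, (a, b)) = a.
  by apply: val_inj; exact: epi_lerp0.
have L1 a b : epigraph_lerp (unit_interval1 R, (a, b)) = b.
  by apply: val_inj; exact: epi_lerp1.
have Lxx t a : epigraph_lerp (t, (a, a)) = a.
  by apply: val_inj; exact: epi_lerpxx.
split.
- exact: equiconnected_contractible epigraph_lerp_continuous L0 L1 c.
- exact: equiconnected_path_connected epigraph_lerp_continuous L0 L1 c.
- exact: equiconnected_simply_connected epigraph_lerp_continuous L0 L1 Lxx c.
Qed.

End Epigraph.

Theorem lemma1 (R : realType) (D : network R) :
  [/\ contractible R (Omega D), path_connected R (Omega D)
    & simply_connected R (Omega D)].
Proof.
(* The lower bounds on the two slack vectors, namely the absolute value and the positive part,
   become the maps whose epigraph is taken. *)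
pose F x : 'cV[R]_(dime D) := \col_j `|gtilde x j 0|.
pose G x : 'cV[R]_(dimi D) := \col_j Num.max (htilde x j 0) 0.
have -> : Omega D = epigraph2 F G.
  by apply/seteqP; split=> z [gz hz]; (split=> j;
    [move: (gz j)|move: (hz j)]); rewrite !mxE.
(* Only continuity of [F] and [G] remains: it follows from that of [gtilde] and [htilde], since
   absolute value and maximum preserve continuity. *)
apply: epigraph2_contractible_connected; apply: continuous_col => j.
  by apply: continuous_fun_norm; exact: continuous_mxE (@gtilde_continuous R D).
apply: continuous_fun_max; last exact: cst_continuous.
exact: continuous_mxE (@htilde_continuous R D).
Qed.
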